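(* Let $M$ be an $n$-dimensional smooth connected manifold, $n\ge2$, with a (regular) Finsler metric $F$ whose line element is expressible in the form $$ds^2=(dx^n)^2+(x^n)^2\,H(x^\alpha,dx^\alpha),\qquad \alpha=1,\dots,n-1,$$ that is, around every point of $M$ there are local coordinates $(x^1,\dots,x^n)$, with induced fibre coordinates $(y^1,\dots,y^n)$, in which $$F^2(x,y)=(y^n)^2+(x^n)^2\,H(x^1,\dots,x^{n-1},y^1,\dots,y^{n-1}),$$ where $H$ is the square of the line element of some $(n-1)$-dimensional Finsler manifold. Then $(M,F)$ is Riemannian.
   Context: A (regular) Finsler metric on a smooth manifold $M$ is a function $F:TM\to\mathbb R$ with $F\ge 0$, $F(0)=0$; $F$ is $C^\infty$ on the whole slit tangent bundle $TM\setminus\{0\}$; $F(x,\lambda y)=\lambda F(x,y)$ for $\lambda>0$; and $g_{ij}(x,y):=\frac12\frac{\partial^2F^2}{\partial y^i\partial y^j}$ is positive definite at each point of $TM\setminus\{0\}$. The ''square of the line element'' of a Finsler manifold $(N,\bar F)$ is the function $\bar F^2$, which is positively homogeneous of degree 2 in the fibre variable. $(M,F)$ is Riemannian if $g_{ij}$ depends on $x$ only, i.e. $F^2(x,y)$ is quadratic in $y$. *)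

(* Defs.v *)
From HB Require Import structures.
From mathcomp Require Import all_boot all_order all_algebra.
From mathcomp Require Import all_classical all_reals all_analysis.
Set Implicit Arguments.
Unset Strict Implicit.
Unset Printing Implicit Defensive.
Import Order.TTheory GRing.Theory Num.Theory.
Import numFieldNormedType.Exports.
Local Open Scope classical_set_scope.
Local Open Scope ring_scope.

(* [Ck k U f] is meant for open [U] and finite-dimensional [V]; there it is
   the usual notion of a function of class C^k on [U]. *)
Fixpoint Ck (R : realType) (V W : normedModType R) (k : nat) (U : set V)
    (f : V -> W) {struct k} : Prop :=
  if k is k'.+1 then
    (forall x, U x -> differentiable f x) /\
    (forall v, Ck k' U (fun x => 'D_v f x))
  else forall x, U x -> {for x, continuous f}.

Definition smooth_on (R : realType) (V W : normedModType R) (U : set V)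
    (f : V -> W) : Prop := forall k, Ck k U f.

(* [coord] and [param] are total functions, but only the values of [coord] on
   [dom] and of [param] on [coord @` dom] are meaningful. *)
Record chart (R : realType) (n : nat) (M : topologicalType) := Chart {
  dom : set M;
  coord : M -> 'rV[R]_n;
  param : 'rV[R]_n -> M;
  dom_open : open dom;
  img_open : open (coord @` dom);
  coordK : forall p, dom p -> param (coord p) = p;
  coord_continuous : forall p, dom p -> {for p, continuous coord};
  param_continuous : forall x, (coord @` dom) x -> {for x, continuous param}
}.

Definition img (R : realType) (n : nat) (M : topologicalType)
  (c : chart R n M) : set 'rV[R]_n := coord c @` dom c.

Definition transition (R : realType) (n : nat) (M : topologicalType)
  (c d : chart R n M) : 'rV[R]_n -> 'rV[R]_n := coord d \o param c.

Definition compatible (R : realType) (n : nat) (M : topologicalType)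
    (c d : chart R n M) : Prop :=
  smooth_on (coord c @` (dom c `&` dom d)) (transition c d) /\
  smooth_on (coord d @` (dom c `&` dom d)) (transition d c).

(* Since the atlas is maximal, its charts are exactly the smooth local
   coordinate systems of the manifold. *)
Record smoothManifold (R : realType) (n : nat) := SmoothManifold {
  carrier :> topologicalType;
  atlas : set (chart R n carrier);
  manifold_hausdorff : hausdorff_space carrier;
  manifold_second_countable : @second_countable carrier;
  atlas_cover : forall p : carrier, exists2 c, atlas c & dom c p;
  atlas_compatible : forall c d, atlas c -> atlas d -> compatible c d;
  atlas_maximal : forall c, (forall d, atlas d -> compatible c d) -> atlas c
}.

Definition chart_at (R : realType) (n : nat) (M : smoothManifold R n) (p : M) :=
  {c : chart R n M | atlas c /\ dom c p}.

(* A tangent vector at [p] is given by its components in all the charts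
   around [p], subject to the transformation law by Jacobians. *)
Record tangent (R : realType) (n : nat) (M : smoothManifold R n) (p : M) :=
  Tangent {
    comp :> chart_at p -> 'rV[R]_n;
    compP : forall c d : chart_at p,
      comp d = 'd (transition (sval c) (sval d)) (coord (sval c) p) (comp c)
  }.

Lemma diff_near_comp (R : realType) (U V W : normedModType R) (f : U -> V)
    (g : V -> W) (h : U -> W) (x y : U) :
  differentiable f x -> differentiable g (f x) -> differentiable h x ->
  (\near x, g (f x) = h x) -> 'd h x y = 'd g (f x) ('d f x y).
Proof.
move=> df dg dh gfh.
have dgf : differentiable (g \o f) x by exact: differentiable_comp.
rewrite -[RHS]/(('d g (f x) \o 'd f x) y) -diff_comp// -!deriveE//.
by apply: near_eq_derive; apply: filterS gfh => z /= ->.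
Qed.

Section TangentOf.
Variables (R : realType) (n : nat) (M : smoothManifold R n) (p : M).

Lemma transition_diff (c d : chart_at p) :
  differentiable (transition (sval c) (sval d)) (coord (sval c) p).
Proof.
case: c d => [c [ac cp]] [d [ad dp]] /=.
have [/(_ 1%N) [+ _] _] := atlas_compatible ac ad.
by apply; exists p.
Qed.

Lemma transition_jacobian (c d e : chart_at p) (y : 'rV[R]_n) :
  'd (transition (sval c) (sval e)) (coord (sval c) p) y =
  'd (transition (sval d) (sval e)) (coord (sval d) p)
    ('d (transition (sval c) (sval d)) (coord (sval c) p) y).
Proof.
have cdp : coord (sval d) p = transition (sval c) (sval d) (coord (sval c) p).
  by rewrite /transition /= coordK//; case: (svalP c).
rewrite cdp; apply: diff_near_comp.
- exact: transition_diff.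
- by rewrite -cdp; exact: transition_diff.
- exact: transition_diff.
have [_ cp] := svalP c; have [_ dp] := svalP d.
have dpar : nbhs (coord (sval c) p) (param (sval c) @^-1` dom (sval d)).
  apply: (@param_continuous _ _ _ (sval c)); first by exists p.
  by rewrite coordK//; apply: open_nbhs_nbhs; split => //; exact: dom_open.
by apply: filterS dpar => z /= dz; rewrite /transition /= coordK.
Qed.

(* The vector at [p] with components [y] in the chart [c], that is
   \sum_i y^i d/dx^i. *)
Definition tangent_of (c : chart_at p) (y : 'rV[R]_n) : tangent p :=
  @Tangent R n M p
    (fun d => 'd (transition (sval c) (sval d)) (coord (sval c) p) y)
    (fun d e => transition_jacobian c d e y).

End TangentOf.

(* A function on TM, curried as F(p, v) with v in T_p M. *)
Definition tfun (R : realType) (n : nat) (M : smoothManifold R n) :=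
  forall p : M, tangent p -> R.

(* The expression F(x, y) of a function on TM in the fibred coordinates
   induced by the chart [c]; it is meaningful for [x \in img c]. *)
Definition in_chart (R : realType) (n : nat) (M : smoothManifold R n)
    (F : tfun M) (c : chart R n M) (x y : 'rV[R]_n) : R :=
  match pselect (atlas c /\ dom c (param c x)) with
  | left h => F (param c x) (tangent_of (exist _ c h) y)
  | right _ => 0
  end.

Definition fundamental_tensor (R : realType) (n : nat)
    (M : smoothManifold R n) (F : tfun M) (c : chart R n M)
    (x y : 'rV[R]_n) (i j : 'I_n) : R :=
  2^-1 * 'D_(delta_mx 0 i)
    (fun u => 'D_(delta_mx 0 j) (fun w => in_chart F c x w ^+ 2) u) y.

Record is_finsler (R : realType) (n : nat) (M : smoothManifold R n)
    (F : tfun M) : Prop := IsFinsler {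
  finsler_ge0 : forall (p : M) (v : tangent p), 0 <= F p v;
  finsler0 : forall c x, atlas c -> img c x -> in_chart F c x 0 = 0;
  finsler_smooth : forall c, atlas c ->
    smooth_on [set z : 'rV[R]_n * 'rV[R]_n | img c z.1 /\ z.2 != 0]
      (fun z => in_chart F c z.1 z.2 : R^o);
  finsler_homogeneous : forall c x y (a : R), atlas c -> img c x -> 0 < a ->
    in_chart F c x (a *: y) = a * in_chart F c x y;
  finsler_posdef : forall c x y (xi : 'rV[R]_n),
    atlas c -> img c x -> y != 0 -> xi != 0 ->
    0 < \sum_(i < n) \sum_(j < n)
          fundamental_tensor F c x y i j * xi 0 i * xi 0 j
}.

Definition is_riemannian (R : realType) (n : nat) (M : smoothManifold R n)
    (F : tfun M) : Prop :=
  forall c x (y y' : 'rV[R]_n) (i j : 'I_n),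
    atlas c -> img c x -> y != 0 -> y' != 0 ->
    fundamental_tensor F c x y i j = fundamental_tensor F c x y' i j.

(* ds^2 = (dx^n)^2 + (x^n)^2 H(x^a, dx^a) around every point of a manifold of
   dimension n.+1: the coordinate called x^n is the last one, [x 0 ord_max],
   and [col' ord_max x] collects the other ones. H is the square of a Finsler
   metric [G] on a manifold [N], read in a chart [d] of [N]. *)
Definition conical_line_element (R : realType) (n : nat)
    (M : smoothManifold R n.+1) (F : tfun M) : Prop :=
  forall p : M, exists c : chart R n.+1 M,
    [/\ atlas c, dom c p &
    exists (N : smoothManifold R n) (G : tfun N) (d : chart R n N),
    [/\ is_finsler G, atlas d &
    forall x y : 'rV[R]_n.+1, img c x ->
      img d (col' ord_max x) /\
      in_chart F c x y ^+ 2 =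
        y 0 ord_max ^+ 2 +
        x 0 ord_max ^+ 2 *
          in_chart G d (col' ord_max x) (col' ord_max y) ^+ 2]].

(* Main.v *)
From mathcomp Require Import all_boot all_order all_algebra.
From mathcomp Require Import all_classical all_reals all_analysis.
From mathcomp Require Import ring.
Require Import Defs.

(** The argument is local and uses the regularity of F in a single direction.
    Fix a point x in a chart where F^2 = (y^n)^2 + (x^n)^2 H, and let
    e = (0, ..., 0, 1) be the direction of the last coordinate. The components
    of e other than the last vanish, so that moving y along a ray from e makes
    the argument of H leave the origin, the one place where the square of a
    Finsler metric may fail to be smooth. Since F is homogeneous, for t >= 0
      F^2(x, e + t y) = F^2(x, e) + 2 y^n t + F^2(x, y) t^2
    ([conical_expansion]). On the other hand F^2(x, .) is twice differentiable
    near e, as e <> 0; along the ray its second derivative at t = 0 is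
    D_y D_y F^2(x, e), a quadratic form in y, and the expansion says that it is
    2 F^2(x, y). Hence F^2(x, .) is a quadratic form on the whole tangent space
    ([quadratic_of_expansion], [finsler_sqr_quadratic]).

    Two charts around a point express F by functions that differ by the
    Jacobian of the transition map, a linear substitution in y
    ([in_chart_change]), so F^2 is quadratic in every chart. The Hessian of a
    quadratic form is constant, which says that the fundamental tensor does not
    depend on the direction. *)

Set Implicit Arguments.
Unset Strict Implicit.
Unset Printing Implicit Defensive.
Import Order.TTheory GRing.Theory Num.Theory.
Import numFieldNormedType.Exports.
Local Open Scope classical_set_scope.
Local Open Scope ring_scope.

(** * Directional derivatives from second-order expansions *)

Lemma cvg_affine0 (R : realType) (b c : R) :
  (b + c * h) @[h --> (0 : R)] --> b.
Proof.
rewrite -[X in _ --> X]addr0 -[X in _ + X](mulr0 c).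
by apply: cvgD; [exact: cvg_cst|apply: cvgM; [exact: cvg_cst|exact: cvg_id]].
Qed.

(** A positively homogeneous function is controlled on half-lines only; when the
    derivative is known to exist, its one-sided value determines it. *)
Lemma derive_right_expansion (R : realType) (V : normedModType R) (f : V -> R)
    (a v : V) (b c : R) :
  derivable f a v ->
  (\forall t \near (0 : R)^'+, f (a + t *: v) = f a + b * t + c * t ^+ 2) ->
  'D_v f a = b.
Proof.
move=> df fE; rewrite /derive cvg_at_rightE//.
have affine : b + c * t @[t --> (0 : R)^'+] --> b.
  by apply: cvg_within_filter; exact: cvg_affine0.
apply: cvg_lim => //; apply: cvg_trans affine.
apply: near_eq_cvg; near=> t.
have t0 : 0 < t by near: t; exact: nbhs_right_gt.
have -> : (f \o shift a) (t *: v) = f a + b * t + c * t ^+ 2.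
  by rewrite /= addrC; near: t; exact: fE.
rewrite /GRing.scale /=; field.
by rewrite gt_eqF.
Unshelve. all: by end_near. Qed.

Lemma is_derive_expansion (R : realType) (V : normedModType R) (f : V -> R)
    (a v : V) (b c : R) :
  (forall t, f (a + t *: v) = f a + b * t + c * t ^+ 2) -> is_derive a v f b.
Proof.
move=> fE.
have cvg_quotient :
    t^-1 *: ((f \o shift a) (t *: v) - f a) @[t --> (0 : R)^'] --> b.
  have affine : b + c * t @[t --> (0 : R)^'] --> b.
    by apply: cvg_within_filter; exact: cvg_affine0.
  apply: cvg_trans affine.
  apply: near_eq_cvg; near=> t.
  have t0 : t != 0 by near: t; exact: nbhs_dnbhs_neq.
  by rewrite /= [t *: v + a]addrC fE /GRing.scale /=; field.
split; first by apply/cvg_ex; exists b.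
exact: cvg_lim.
Unshelve. all: by end_near. Qed.

(** * Quadratic forms *)

Definition quadratic_form (R : realType) (m : nat) (q : 'rV[R]_m -> R) : Prop :=
  exists A : 'M[R]_m, forall y, q y = (y *m A *m y^T) 0 0.

Lemma quadratic_form_linear (R : realType) (m p : nat) (q : 'rV[R]_m -> R)
    (L : {linear 'rV[R]_p -> 'rV[R]_m}) :
  quadratic_form q -> quadratic_form (q \o L).
Proof.
move=> [A qA]; exists (lin1_mx L *m A *m (lin1_mx L)^T) => y /=.
by rewrite qA -mul_rV_lin1 trmx_mul !mulmxA.
Qed.

Lemma derive_quadratic_form (R : realType) (m : nat) (A : 'M[R]_m)
    (v y : 'rV[R]_m) :
  'D_v (fun w => (w *m A *m w^T) 0 0) y =
  (y *m A *m v^T) 0 0 + (v *m A *m y^T) 0 0.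
Proof.
have H : is_derive y v (fun w => (w *m A *m w^T) 0 0)
    ((y *m A *m v^T) 0 0 + (v *m A *m y^T) 0 0).
  apply: (@is_derive_expansion _ _ _ _ _ _ ((v *m A *m v^T) 0 0)) => t.
  rewrite linearD /= linearZ /= !(mulmxDl, mulmxDr) -!(scalemxAl, scalemxAr) !mxE.
  ring.
exact: derive_val.
Qed.

Lemma derive2_quadratic_form (R : realType) (m : nat) (A : 'M[R]_m)
    (u v y : 'rV[R]_m) :
  'D_u (fun z => 'D_v (fun w => (w *m A *m w^T) 0 0) z) y =
  (u *m A *m v^T) 0 0 + (v *m A *m u^T) 0 0.
Proof.
under eq_fun => z do rewrite derive_quadratic_form.
have H : is_derive y u (fun z => (z *m A *m v^T) 0 0 + (v *m A *m z^T) 0 0)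
    ((u *m A *m v^T) 0 0 + (v *m A *m u^T) 0 0).
  apply: (@is_derive_expansion _ _ _ _ _ _ 0) => t.
  rewrite linearD /= linearZ /= !(mulmxDl, mulmxDr) -!(scalemxAl, scalemxAr) !mxE.
  ring.
exact: derive_val.
Qed.

Lemma derive_coord (R : realType) (m : nat) (f : 'rV[R]_m -> R)
    (a v : 'rV[R]_m) :
  differentiable f a ->
  'D_v f a = \sum_i v 0 i * 'D_(delta_mx 0 i) f a.
Proof.
move=> df; rewrite deriveE// {1}(row_sum_delta v) linear_sum /=.
by apply: eq_bigr => i _; rewrite linearZ /= deriveE.
Qed.

(** The derivative of f in the direction y at e + t y is b y + 2 (q y) t for
    small t >= 0, so its derivative in the direction y at e is 2 (q y). Expanding
    both directions in the canonical basis turns this second derivative into a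
    quadratic expression in the coordinates of y. The family df provides the
    directional derivatives of f near e, so that a convenient formula for them
    can be shown differentiable in their place. *)
Lemma quadratic_of_expansion (R : realType) (m : nat) (f : 'rV[R]_m -> R)
    (df : 'rV[R]_m -> 'rV[R]_m -> R) (e : 'rV[R]_m) (b q : 'rV[R]_m -> R) :
  (\forall y \near e, differentiable f y) ->
  (forall v, \forall y \near e, 'D_v f y = df v y) ->
  (forall v, differentiable (df v) e) ->
  (forall y t, 0 <= t -> f (e + t *: y) = f e + b y * t + q y * t ^+ 2) ->
  quadratic_form q.
Proof.
move=> diff_f dfE diff_df fE.
have ray y : e + t *: y @[t --> (0 : R)^'+] --> e.
  apply: cvg_within_filter.
  have : e + t *: y @[t --> (0 : R)] --> e + 0 *: y.
    by apply: cvgD; [exact: cvg_cst|apply: cvgZ; [exact: cvg_id|exact: cvg_cst]].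
  by rewrite scale0r addr0.
have dfeE v : df v e = 'D_v f e by rewrite (nbhs_singleton (dfE v)).
have qE y : 'D_y (df y) e = 2 * q y.
  apply: (@derive_right_expansion _ _ _ _ _ _ 0).
    exact: diff_derivable.
  near=> t; rewrite mul0r addr0.
  have t0 : 0 < t by near: t; exact: nbhs_right_gt.
  have diff_ft : differentiable f (e + t *: y).
    by near: t; exact: ray diff_f.
  have <- : 'D_y f (e + t *: y) = df y (e + t *: y).
    by near: t; exact: ray (dfE y).
  have -> : df y e = b y.
    rewrite dfeE; apply: (@derive_right_expansion _ _ _ _ _ _ (q y)).
      by apply: diff_derivable; exact: nbhs_singleton diff_f.
    near=> s; apply: fE; apply: ltW; near: s; exact: nbhs_right_gt.
  (* At e + t y the expansion in s is the one at e evaluated at t + s. *)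
  apply: (@derive_right_expansion _ _ _ _ _ _ (q y)).
    exact: diff_derivable.
  near=> s; have s0 : 0 < s by near: s; exact: nbhs_right_gt.
  by rewrite -addrA -scalerDl !fE ?addr_ge0 ?ltW//; ring.
exists (\matrix_(j, i) (2^-1 * 'D_(delta_mx 0 j) (df (delta_mx 0 i)) e)) => y.
have -> : q y = 2^-1 * 'D_y (df y) e by rewrite qE; field.
have -> : 'D_y (df y) e = 'D_y (\sum_i (y 0 i *: df (delta_mx 0 i))) e.
  have dfiE : \forall z \near e,
      forall i, 'D_(delta_mx 0 i) f z = df (delta_mx 0 i) z.
    apply: (@filter_forall _ _ (fun i z =>
      'D_(delta_mx 0 i) f z = df (delta_mx 0 i) z) (nbhs e)) => i; exact: dfE.
  apply: near_eq_derive; near=> z.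
  rewrite fct_sumE -(near (dfE y) z)// derive_coord; last by near: z.
  by apply: eq_bigr => i _; rewrite (near dfiE z).
rewrite derive_sum; last first.
  by move=> i; apply: derivableZ; exact: diff_derivable.
rewrite mulr_sumr !mxE; apply: eq_bigr => i _.
rewrite deriveZ; last exact: diff_derivable.
rewrite derive_coord// /GRing.scale /= !mxE !big_distrl /= !mulr_sumr.
by apply: eq_bigr => j _; rewrite !mxE; ring.
Unshelve. all: by end_near. Qed.

(** * Functions on the tangent bundle in charts *)

Lemma in_chart_coord (R : realType) (n : nat) (M : smoothManifold R n)
    (F : tfun M) (p : M) (c : chart_at p) (y : 'rV[R]_n) :
  in_chart F (sval c) (coord (sval c) p) y = F p (tangent_of c y).
Proof.
case: c => c h /=; rewrite /in_chart.
case: pselect => [h'|[]]; last by rewrite coordK//; case: h.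
move: h'; rewrite coordK; last by case: h.
by move=> h'; rewrite (Prop_irrelevance h' h).
Qed.

Lemma tangent_ext (R : realType) (n : nat) (M : smoothManifold R n) (p : M)
    (u v : tangent p) : comp u =1 comp v -> u = v.
Proof.
case: u v => [u uP] [v vP] /= /funext uv; move: uP; rewrite uv => uP.
by rewrite (Prop_irrelevance uP vP).
Qed.

(** Both sides evaluate F at one and the same tangent vector: a vector is determined
    by its components in all charts, and Jacobians of transition maps compose. *)
Lemma in_chart_change (R : realType) (n : nat) (M : smoothManifold R n)
    (F : tfun M) (p : M) (c d : chart_at p) (y : 'rV[R]_n) :
  in_chart F (sval c) (coord (sval c) p) y =
  in_chart F (sval d) (coord (sval d) p)
    ('d (transition (sval c) (sval d)) (coord (sval c) p) y).
Proof.
rewrite !in_chart_coord; congr (F p _).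
by apply: tangent_ext => e /=; exact: transition_jacobian.
Qed.

Lemma fundamental_tensor_quadratic (R : realType) (n : nat)
    (M : smoothManifold R n) (F : tfun M) (c : chart R n M) (x : 'rV[R]_n) :
  quadratic_form (fun y => in_chart F c x y ^+ 2) ->
  forall (y y' : 'rV[R]_n) (i j : 'I_n),
    fundamental_tensor F c x y i j = fundamental_tensor F c x y' i j.
Proof.
move=> [A FA] y y' i j; rewrite /fundamental_tensor.
have -> : (fun w => in_chart F c x w ^+ 2) = (fun w => (w *m A *m w^T) 0 0).
  exact/funext.
by rewrite !derive2_quadratic_form.
Qed.

(** * Finsler metrics along a fibre *)

Section FibreRegularity.
Variables (R : realType) (n : nat) (M : smoothManifold R n) (F : tfun M).
Variables (c : chart R n M) (x : 'rV[R]_n).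
Hypotheses (finF : is_finsler F) (ac : atlas c) (cx : img c x).

Let total (z : 'rV[R]_n * 'rV[R]_n) : R^o := in_chart F c z.1 z.2.

Let differentiable_fibre (W : normedModType R) (g : 'rV[R]_n * 'rV[R]_n -> W)
  (y : 'rV[R]_n) :
  differentiable g (x, y) -> differentiable (fun y => g (x, y)) y.
Proof.
by move=> dg; apply: (@differentiable_comp _ _ _ _ (fun y => (x, y)) g).
Qed.

Let derive_fibre (v y : 'rV[R]_n) :
  'D_v (in_chart F c x) y = 'D_(0, v) total (x, y).
Proof.
have quotientE :
    (fun h => h^-1 *: ((in_chart F c x \o shift y) (h *: v) - in_chart F c x y)) =
    (fun h => h^-1 *: ((total \o shift (x, y)) (h *: (0, v)) - total (x, y))).
  by apply/funext => h; rewrite /total /= scaler0 add0r.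
by rewrite /derive quotientE.
Qed.

Lemma finsler_differentiable (y : 'rV[R]_n) :
  y != 0 -> differentiable (in_chart F c x) y.
Proof.
move=> y0; have [dF _] := finsler_smooth finF ac 1%N.
exact: differentiable_fibre (dF (x, y) (conj cx y0)).
Qed.

Lemma finsler_derive_differentiable (v y : 'rV[R]_n) :
  y != 0 -> differentiable (fun y => 'D_v (in_chart F c x) y) y.
Proof.
move=> y0; have [_ /(_ (0, v)) [dF _]] := finsler_smooth finF ac 2%N.
under eq_fun => z do rewrite derive_fibre.
exact: differentiable_fibre (dF (x, y) (conj cx y0)).
Qed.

End FibreRegularity.

Lemma nbhs_row_neq0 (R : realType) (m : nat) (e : 'rV[R]_m) :
  e != 0 -> \forall y \near e, y != 0.
Proof.
move=> /eqP e0.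
have open_neq0 : open (~` [set (0 : 'rV[R]_m)]).
  apply: closed_openC; apply: accessible_closed_set1.
  exact: hausdorff_accessible (@norm_hausdorff _ _).
by apply: filterS (open_nbhs_nbhs (conj open_neq0 e0)) => y /eqP.
Qed.

(** Away from the zero section F is of class C^2, so e can serve as the base point of
    the second-order expansion; the derivatives of F^2 are written 2 F D_v F. *)
Lemma finsler_sqr_quadratic (R : realType) (n : nat) (M : smoothManifold R n)
    (F : tfun M) (c : chart R n M) (x e : 'rV[R]_n) (b : 'rV[R]_n -> R) :
  is_finsler F -> atlas c -> img c x -> e != 0 ->
  (forall y t, 0 <= t ->
    in_chart F c x (e + t *: y) ^+ 2 =
    in_chart F c x e ^+ 2 + b y * t + in_chart F c x y ^+ 2 * t ^+ 2) ->
  quadratic_form (fun y => in_chart F c x y ^+ 2).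
Proof.
move=> finF ac cx e0; set f := in_chart F c x.
apply: (@quadratic_of_expansion _ _ (fun y => f y ^+ 2)
  (fun v y => 2 * (f y * 'D_v f y))).
- near=> y; apply: (@differentiableX _ _ f 1).
  by apply: finsler_differentiable => //; near: y; exact: nbhs_row_neq0.
- move=> v; near=> y.
  have fy : derivable f y v.
    apply: diff_derivable; apply: finsler_differentiable => //.
    by near: y; exact: nbhs_row_neq0.
  have := deriveX 2 fy; rewrite expr1 /GRing.scale /= -mulrA; exact.
- move=> v; apply: differentiableM; first exact: differentiable_cst.
  apply: differentiableM; first exact: finsler_differentiable.
  exact: finsler_derive_differentiable.
Unshelve. all: by end_near. Qed.

(** With u the components of y other than the last one, the cone formula at
    e + t y gives (1 + t y^n)^2 + a h(t u), and a h(t u) = t^2 a h(u) by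
    homogeneity of F, since a h is the difference of F^2 and the square of the last
    coordinate. *)
Lemma conical_expansion (R : realType) (n : nat) (F : 'rV[R]_n.+1 -> R)
    (a : R) (h : 'rV[R]_n -> R) :
  (forall y, F y ^+ 2 = y 0 ord_max ^+ 2 + a * h (col' ord_max y)) ->
  F 0 = 0 -> (forall t y, 0 < t -> F (t *: y) = t * F y) ->
  let e := delta_mx 0 ord_max in
  forall y t, 0 <= t ->
    F (e + t *: y) ^+ 2 =
    F e ^+ 2 + 2 * y 0 ord_max * t + F y ^+ 2 * t ^+ 2.
Proof.
move=> FE F0 Fhom e y t t0.
have FhomE : F (t *: y) = t * F y.
  move: t0; rewrite le_eqVlt => /predU1P[<-|]; last exact: Fhom.
  by rewrite scale0r mul0r.
have col_e u : col' ord_max (e + u) = col' ord_max u.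
  by apply/rowP => k; rewrite !mxE eq_sym (negbTE (neq_lift _ _)) andbF add0r.
have e_max : e 0 ord_max = 1 by rewrite mxE !eqxx.
have h0 : a * h 0 = 0.
  have := FE 0; rewrite F0 mxE expr0n add0r /= => /esym.
  by congr (_ * h _ = _); apply/rowP => k; rewrite !mxE.
have Fe : F e ^+ 2 = 1.
  by rewrite FE e_max -[e]addr0 col_e raddf0 h0 addr0 expr1n.
have ah : a * h (col' ord_max (t *: y)) =
    (t * F y) ^+ 2 - (t *: y) 0 ord_max ^+ 2 by rewrite -FhomE FE; ring.
by rewrite FE col_e ah Fe mxE e_max mxE; ring.
Qed.

Theorem theorem4p2 (R : realType) (n : nat) (M : smoothManifold R n.+1)
    (F : tfun M) :
  (2 <= n.+1)%N ->
  connected [set: M] ->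
  is_finsler F ->
  conical_line_element F ->
  is_riemannian F.
Proof.
move=> _ _ finF conF c _ y y' i j ac [p cp <-] _ _.
apply: fundamental_tensor_quadratic.
have [d [ad dp [N [G [g [_ _ FE]]]]]] := conF p.
have dx : img d (coord d p) by exists p.
have qF : quadratic_form (fun w => in_chart F d (coord d p) w ^+ 2).
  apply: (@finsler_sqr_quadratic _ _ _ _ _ _ (delta_mx 0 ord_max)
    (fun w => 2 * w 0 ord_max)) => //.
    by apply/eqP => /rowP/(_ ord_max); rewrite !mxE !eqxx => /eqP; rewrite oner_eq0.
  apply: (@conical_expansion _ _ _ (coord d p 0 ord_max ^+ 2)
    (fun w => in_chart G g (col' ord_max (coord d p)) w ^+ 2)).
  - by move=> w; have [] := FE _ w dx.
  - exact: finsler0.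
  - by move=> t w t0; exact: finsler_homogeneous.
pose cC : chart_at p := exist _ c (conj ac cp).
pose dC : chart_at p := exist _ d (conj ad dp).
have -> : (fun w => in_chart F c (coord c p) w ^+ 2) =
    (fun w => in_chart F d (coord d p) w ^+ 2) \o
      'd (transition c d) (coord c p).
  by apply/funext => w /=; rewrite (in_chart_change F cC dC).
exact: quadratic_form_linear.
Qed.
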